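(* Let $V$ be a finite-dimensional real vector space, $\mathcal{K}\subset V$ a closed convex cone, $e\neq0$ an interior point of $\mathcal{K}$, and $\mathcal{B}=\{\ell\in\mathcal{K}^\vee : \ell(e)=1\}$. Let $\pi:V^\ast\to(\mathbb{R}^n)^\ast$ be a linear map, let $\pi_0:V^\ast\to(\mathbb{R}\oplus\mathbb{R}^n)^\ast$, $\ell\mapsto(\ell(e),\pi(\ell))$, let $\phi_0:\mathbb{R}\oplus\mathbb{R}^n\to V$ be the dual map of $\pi_0$, and let $\pi_2:(\mathbb{R}\oplus\mathbb{R}^n)^\ast\to(\mathbb{R}^n)^\ast$, $(y_0,y)\mapsto y$. Put $C=\phi_0^{-1}(\mathcal{K})\subset\mathbb{R}\oplus\mathbb{R}^n$ and $\operatorname{h}_{b_0}(C^\vee)=\{(y_0,y)\in C^\vee : y_0=1\}$. Then: 1. The image of the convex cone $\mathcal{K}^\vee$ under $\pi_0$ is the closed convex cone $\pi_0(\mathcal{K}^\vee)=C^\vee$. 2. The image of $\mathcal{B}$ under $\pi_0$ is the compact base $\pi_0(\mathcal{B})=\operatorname{h}_{b_0}(C^\vee)$ of $C^\vee$. 3. $\pi(\mathcal{B})=\pi_2(\operatorname{h}_{b_0}(C^\vee))$.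
   Context: A subset $C$ of a real vector space is a cone if $\lambda x\in C$ whenever $\lambda>0$ and $x\in C$. A convex cone is a nonempty convex set $K$ with $\lambda x\in K$ whenever $\lambda\ge0$, $x\in K$. For a subset $S$ of a finite-dimensional real vector space $V$, the dual convex cone is $S^\vee=\{\ell\in V^\ast : \ell(x)\ge 0\ \forall x\in S\}$. A subset $B$ is a base of a cone $C$ if $B$ is the intersection of $C$ with an affine hyperplane, $0\notin\operatorname{aff}(B)$ (the affine hull), and for every nonzero $x\in C$ there exist $y\in B$ and $\lambda>0$ with $x=\lambda y$. $b_0$ denotes the first standard basis vector of $\mathbb{R}\oplus\mathbb{R}^n=\mathbb{R}^{n+1}$. *)

(* Defs.v *)
From HB Require Import structures.
From mathcomp Require Import all_boot all_order all_algebra.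
From mathcomp Require Import all_classical all_reals all_analysis.

Set Implicit Arguments.
Unset Strict Implicit.
Unset Printing Implicit Defensive.

Import Order.TTheory GRing.Theory Num.Theory.
Import numFieldNormedType.Exports.
Import VectorInternalTheory.

Local Open Scope classical_set_scope.
Local Open Scope ring_scope.

(* Convention: the dual space of V : vectType R is 'Hom(V, R^o), which is
   again a vectType. *)

(* A vectType carries no topology in the library.  The canonical topology of a
   finite-dimensional real vector space is the one for which some (equivalently
   any) linear isomorphism with R^d is a homeomorphism; v2r is such an
   isomorphism, so this is the initial topology of v2r. *)
Definition fdtop (R : realType) (V : vectType R) : topologicalType :=
  initial_topology (v2r : V -> 'rV[R]_(dim V)).

Section Cones.
Context {R : realType} {V : vectType R}.
Implicit Types (B C K : set V).

Definition is_cone C := forall (a : R) x, 0 < a -> C x -> C (a *: x).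

Definition is_convex_cone K :=
  [/\ K !=set0, convex_set K &
      forall (a : R) x, 0 <= a -> K x -> K (a *: x)].

Definition dual_cone (S : set V) : set 'Hom(V, R^o) :=
  [set l | forall x, S x -> 0 <= l x].

Definition affine_hyperplane (H : set V) :=
  exists (f : 'Hom(V, R^o)) (c : R), f != 0 /\ H = [set x | f x = c].

Definition affine_hull (S : set V) : set V :=
  [set x | exists (k : nat) (p : 'I_k -> V) (a : 'I_k -> R),
     [/\ forall i, S (p i), \sum_(i < k) a i = 1 &
         x = \sum_(i < k) a i *: p i]].

Definition is_base B C :=
  [/\ is_cone C,
      exists2 H, affine_hyperplane H & B = C `&` H,
      ~ affine_hull B 0 &
      forall x, C x -> x != 0 ->
        exists y (a : R), [/\ B y, 0 < a & x = a *: y]].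

(* The section of a set of linear forms by the affine hyperplane of the forms
   taking the value 1 at b *)
Definition hsection (b : V) (S : set 'Hom(V, R^o)) : set 'Hom(V, R^o) :=
  S `&` [set l | l b = 1].

End Cones.

Section DualMap.
Context {R : realType}.
Implicit Types V W : vectType R.

Definition dual_map V W (f : 'Hom(V, W)) : 'Hom('Hom(W, R^o), 'Hom(V, R^o)) :=
  linfun (fun l : 'Hom(W, R^o) => (l \o f)%VF).

Definition bidual V : 'Hom(V, 'Hom('Hom(V, R^o), R^o)) :=
  linfun (fun x : V => linfun (fun l : 'Hom(V, R^o) => l x)).

(* The dual of f : W^* -> V^* is a map V^** -> W^**; this is the map V -> W
   that it becomes when both spaces are identified with their biduals. *)
Definition predual_map V W (f : 'Hom('Hom(W, R^o), 'Hom(V, R^o))) :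
    'Hom(V, W) :=
  ((bidual W)^-1 \o dual_map f \o bidual V)%VF.

Lemma dual_mapE V W (f : 'Hom(V, W)) (l : 'Hom(W, R^o)) x : dual_map f l x = l (f x).
Proof.
have lin : linear (fun l : 'Hom(W, R^o) => (l \o f)%VF).
  by move=> a u v; rewrite comp_lfunDl comp_lfunZl.
pose L : {linear _ -> _} := HB.pack (fun l : 'Hom(W, R^o) => (l \o f)%VF)
  (GRing.isLinear.Build _ _ _ _ _ lin).
by rewrite /dual_map (lfunE L) /= comp_lfunE.
Qed.

Lemma bidualE V (x : V) (l : 'Hom(V, R^o)) : bidual V x l = l x.
Proof.
have lin1 (y : V) : linear (fun l : 'Hom(V, R^o) => l y).
  by move=> a u v; rewrite add_lfunE scale_lfunE.
pose L1 (y : V) : {linear _ -> _} := HB.pack (fun l : 'Hom(V, R^o) => l y)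
  (GRing.isLinear.Build _ _ _ _ _ (lin1 y)).
have ev y m : linfun (fun l : 'Hom(V, R^o) => l y) m = m y.
  by rewrite (lfunE (L1 y)).
have lin2 : linear (fun y : V => linfun (fun l : 'Hom(V, R^o) => l y)).
  by move=> a u v; apply/lfunP => m; rewrite add_lfunE scale_lfunE !ev linearP.
pose L2 : {linear _ -> _} :=
  HB.pack (fun y : V => linfun (fun l : 'Hom(V, R^o) => l y))
  (GRing.isLinear.Build _ _ _ _ _ lin2).
by rewrite /bidual (lfunE L2) /= ev.
Qed.

Lemma bidual_inj V : injective (bidual V).
Proof.
move=> x y exy; apply: v2r_inj; apply/rowP => j.
have lin : linear (fun z : V => v2r z ord0 j : R^o).
  by move=> a u v; rewrite linearP !mxE.
pose L : {linear V -> R^o} := HB.pack (fun z : V => v2r z ord0 j : R^o)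
  (GRing.isLinear.Build _ _ _ _ _ lin).
have := congr1 (fun g : 'Hom('Hom(V, R^o), R^o) => g (linfun L)) exy.
by rewrite !bidualE !lfunE.
Qed.

Lemma bidualVK V : cancel (bidual V)^-1%VF (bidual V).
Proof.
move=> g; apply: limg_lfunVK.
have -> : limg (bidual V) = fullv; last exact: memvf.
apply/eqP; rewrite eqEdim subvf /= limg_dim_eq; last first.
  by have /lker0P/eqP -> := @bidual_inj V; rewrite capv0.
by rewrite !dimvf /dim /= /dim /= !muln1.
Qed.

Lemma predual_mapE V W (f : 'Hom('Hom(W, R^o), 'Hom(V, R^o)))
    (l : 'Hom(W, R^o)) (x : V) :
  l (predual_map f x) = f l x.
Proof. by rewrite -bidualE !comp_lfunE bidualVK dual_mapE bidualE. Qed.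

End DualMap.

Section Pi0.
Context {R : realType} {V : vectType R} {n : nat}.

(* (y0, y) as an element of the dual of R (+) R^n *)
Definition dual_pair (y0 : R) (y : 'Hom('rV[R]_n, R^o)) :
    'Hom((R^o * 'rV[R]_n)%type, R^o) :=
  linfun (fun x : R^o * 'rV[R]_n => y0 * x.1 + y x.2 : R^o).

Definition b0 : R^o * 'rV[R]_n := (1, 0).

Definition pi0 (e : V) (pi : 'Hom('Hom(V, R^o), 'Hom('rV[R]_n, R^o))) :
    'Hom('Hom(V, R^o), 'Hom((R^o * 'rV[R]_n)%type, R^o)) :=
  linfun (fun l : 'Hom(V, R^o) => dual_pair (l e) (pi l)).

(* (y0, y) |-> y, that is, restriction of linear forms to the summand R^n *)
Definition pi2 : 'Hom('Hom((R^o * 'rV[R]_n)%type, R^o), 'Hom('rV[R]_n, R^o)) :=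
  dual_map (linfun (fun x : 'rV[R]_n => (0, x) : R^o * 'rV[R]_n)).

Lemma dual_pairE y0 (y : 'Hom('rV[R]_n, R^o)) x : dual_pair y0 y x = y0 * x.1 + y x.2.
Proof.
have lin : linear (fun x : R^o * 'rV[R]_n => y0 * x.1 + y x.2 : R^o).
  move=> a u v /=; rewrite linearP mulrDr scalerDr addrACA.
  by congr (_ + _ + _); rewrite -![_ *: _]/(_ * _) mulrCA.
pose L : {linear _ -> _} :=
  HB.pack (fun x : R^o * 'rV[R]_n => y0 * x.1 + y x.2 : R^o)
  (GRing.isLinear.Build _ _ _ _ _ lin).
by rewrite /dual_pair (lfunE L).
Qed.

Lemma dual_pair_b0 y0 y : dual_pair y0 y b0 = y0.
Proof. by rewrite dual_pairE /= mulr1 linear0 addr0. Qed.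

Lemma pi2E (m : 'Hom((R^o * 'rV[R]_n)%type, R^o)) x : pi2 m x = m (0, x).
Proof.
have lin : linear (fun x : 'rV[R]_n => (0, x) : R^o * 'rV[R]_n).
  by move=> a u v; congr (_, _); rewrite /= scaler0 addr0.
pose L : {linear _ -> _} :=
  HB.pack (fun x : 'rV[R]_n => (0, x) : R^o * 'rV[R]_n)
  (GRing.isLinear.Build _ _ _ _ _ lin).
by rewrite dual_mapE (lfunE L).
Qed.

Lemma pi2_dual_pair y0 y : pi2 (dual_pair y0 y) = y.
Proof. by apply/lfunP => x; rewrite pi2E dual_pairE /= mulr0 add0r. Qed.

Lemma dual_pair_eta (m : 'Hom((R^o * 'rV[R]_n)%type, R^o)) :
   dual_pair (m b0) (pi2 m) = m.
Proof.
apply/lfunP => x; rewrite dual_pairE pi2E mulrC -[_ * _]/(_ *: _).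
rewrite -linearZ -linearD; congr (m _); case: x => x0 x.
by congr (_, _); rewrite /= ?scaler0 ?add0r // addr0 -[_ *: _]/(_ * _) mulr1.
Qed.

Lemma pi0E e (pi : 'Hom('Hom(V, R^o), 'Hom('rV[R]_n, R^o))) l :
  pi0 e pi l = dual_pair (l e) (pi l).
Proof.
have lin : linear (fun l : 'Hom(V, R^o) => dual_pair (l e) (pi l)).
  move=> a u v; apply/lfunP => x.
  rewrite [RHS]add_lfunE (scale_lfunE a (dual_pair _ _)) !dual_pairE.
  rewrite [pi (_ + _)]linearP !add_lfunE !scale_lfunE -![_ *: _]/(_ * _).
  by rewrite mulrDl mulrDr addrACA !mulrA.
pose L : {linear _ -> _} :=
  HB.pack (fun l : 'Hom(V, R^o) => dual_pair (l e) (pi l))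
  (GRing.isLinear.Build _ _ _ _ _ lin).
by rewrite /pi0 (lfunE L).
Qed.

End Pi0.

(* Main.v *)
(* Forms l in K^vee satisfy (pi0 l) x = l (phi0 x), so pi0 sends K^vee into
   C^vee.  Conversely a form m in C^vee is nonnegative on ker phi0, hence zero
   there, and so factors through a form on the image of phi0 that is
   nonnegative on the part of K in that image.  The image contains the interior
   point e = phi0 b0, which is an order unit of K, so M. Riesz's argument,
   adding one dimension at a time, extends the form to V while keeping it
   nonnegative on K.
   Since b0 is an order unit of C, every x has a constant M with
   |m x| <= M * m b0 for all m in C^vee.  This bounds the section m b0 = 1, and
   it forces m = 0 when m b0 = 0, so the section is a base. *)
Require Import Defs.
From HB Require Import structures.
From mathcomp Require Import all_boot all_order all_algebra.
From mathcomp Require Import all_classical all_reals all_analysis.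
From mathcomp Require Import lra.

Set Implicit Arguments.
Unset Strict Implicit.
Unset Printing Implicit Defensive.

Import Order.TTheory GRing.Theory Num.Theory.
Import numFieldNormedType.Exports.

Local Open Scope classical_set_scope.
Local Open Scope ring_scope.

Import VectorInternalTheory.

(** * Extension of positive linear forms *)

Lemma separating_functional (R : realType) (V : vectType R)
    (U : {vspace V}) (v : V) :
  v \notin U ->
  exists2 f : 'Hom(V, R^o), (forall u, u \in U -> f u = 0) & f v = 1.
Proof.
move=> vU; pose w := v - projv U v.
have w0 : w != 0.
  apply: contraNneq vU => /eqP; rewrite subr_eq0 => /eqP ->.
  exact: memv_proj.
(* If every form vanished at [w], then [w] and 0 would have the same image in the bidual. *)
have [g gw] : exists g : 'Hom(V, R^o), g w != 0.
  apply: contrapT => /forallNP g0; move/eqP: w0; apply; apply: bidual_inj.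
  apply/lfunP => g; rewrite !bidualE linear0.
  by apply/eqP/negPn/negP/g0.
pose f := ((g w)^-1 *: (g \o (\1 - projv U)))%VF.
have fE x : f x = (g w)^-1 * g (x - projv U x).
  by rewrite scale_lfunE comp_lfunE add_lfunE opp_lfunE id_lfunE.
exists f => [u uU|]; rewrite fE ?mulVf//.
by rewrite projv_id// subrr linear0 mulr0.
Qed.

Section PositiveExtension.
Context {R : realType} {V : vectType R} (K : set V) (e : V).
Hypothesis Kcone : is_convex_cone K.

Lemma convex_cone0 : K 0.
Proof.
by case: Kcone => -[x Kx] _ KZ; rewrite -(scale0r x); apply: KZ.
Qed.

(** The sum is twice the midpoint. *)
Lemma convex_coneD x y : K x -> K y -> K (x + y).
Proof.
case: Kcone => _ Kconv KZ Kx Ky.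
have h0 : 0 <= 2^-1 :> R by rewrite invr_ge0 ler0n.
have h1 : 2^-1 <= 1 :> R by rewrite invf_le1 ?ler1n ?ltr0n.
have /set_mem/(KZ 2 _ (ler0n _ 2)) :=
  Kconv x y (Itv01 h0 h1) (mem_set Kx) (mem_set Ky).
congr (K _).
rewrite /conv /= scalerDr !scalerA mulrBr mulr1 divff ?pnatr_eq0//.
by rewrite -natr1 addrK !scale1r.
Qed.

Hypothesis e_unit : forall x, exists t : R, K (t *: e + x).

(** Only the value at [v] is free. It must lie above every [m u] with [v - u] in [K] and below every
    [m u] with [u - v] in [K]. The order unit makes both families nonempty, and positivity of [m] on
    [U] puts the first below the second. Adding a multiple of [f] adjusts this value without
    changing the form on [U]. *)
Lemma positive_extension_step (U : {vspace V}) v (m : 'Hom(V, R^o)) :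
  e \in U -> (forall u, u \in U -> K u -> 0 <= m u) -> v \notin U ->
  exists2 l : 'Hom(V, R^o), (forall u, u \in U -> l u = m u) &
    forall u, u \in (U + <[v]>)%VS -> K u -> 0 <= l u.
Proof.
move=> eU m0 vU; have [f fU fv] := separating_functional vU.
pose L := [set r | exists u, [/\ u \in U, K (v - u) & r = m u]].
have Lub u : u \in U -> K (u - v) -> ubound L (m u).
  move=> uU Ku _ [w [wU Kw ->]]; rewrite -subr_ge0 -linearB.
  apply: m0; first exact: rpredB.
  by rewrite -(subrK v u) -addrA; exact: convex_coneD.
have L0 : L !=set0.
  have [t Kt] := e_unit v; exists (m (- t *: e)), (- t *: e); split=> //.
    exact: rpredZ.
  by rewrite scaleNr opprK addrC.
have Lubd : has_ubound L.
  have [t Kt] := e_unit (- v); exists (m (t *: e)); apply: Lub => //.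
  exact: rpredZ.
(* The value at v must be an upper bound of L and a lower bound of the m u with
   u - v in K; sup L is both. *)
exists (m + (sup L - m v) *: f)
  => [u uU|_ /memv_addP[u uU [w /vlineP[a ->] ->]] Ku].
  by rewrite add_lfunE scale_lfunE fU// scaler0 addr0.
have -> : (m + (sup L - m v) *: f) (u + a *: v) = m u + a * sup L.
  rewrite add_lfunE scale_lfunE !linearD !linearZ/= fU//.
  rewrite fv scaler0 add0r -![_ *: _]/(_ * _) mulr1 -addrA -mulrDr.
  by rewrite [m v + _]addrC subrK.
have [_ _ KZ] := Kcone.
(* Dividing [u + a *: v] by [|a|] shows that [- a^-1 *: u] lies above [v] if [a < 0] and below [v]
   if [a > 0], in the order given by [K]. *)
have [a0|a0|a0] := ltgtP a 0.
- have -> : m u + a * sup L = - a * (m (- a^-1 *: u) - sup L).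
    rewrite linearZ/= -[_ *: _]/(_ * _) mulrBr mulrA mulrNN divff ?lt_eqF//.
    by rewrite mul1r mulNr opprK.
  apply: mulr_ge0; first by rewrite oppr_ge0 ltW.
  rewrite subr_ge0; apply: ge_sup => //.
  apply: Lub; first exact: rpredZ.
  have := KZ (- a^-1) _ _ Ku; rewrite scalerDr scalerA mulNr mulVf ?lt_eqF//.
  by rewrite scaleN1r; apply; rewrite oppr_ge0 invr_le0 ltW.
- have -> : m u + a * sup L = a * (sup L - m (- a^-1 *: u)).
    rewrite linearZ/= -[_ *: _]/(_ * _) mulNr opprK mulrDr mulrA.
    by rewrite divff ?gt_eqF// mul1r addrC.
  apply: mulr_ge0; first exact: ltW.
  rewrite subr_ge0; apply: ub_le_sup => //.
  exists (- a^-1 *: u); split => //; first exact: rpredZ.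
  have := KZ a^-1 _ _ Ku; rewrite scalerDr scalerA mulVf ?gt_eqF// scale1r.
  by rewrite scaleNr opprK addrC; apply; rewrite invr_ge0 ltW.
- by move: Ku; rewrite a0 scale0r mul0r !addr0; exact: m0.
Qed.

(** Induction on the codimension of [U], which drops whenever a vector outside [U] is adjoined. *)
Lemma positive_extension (U : {vspace V}) (m : 'Hom(V, R^o)) :
  e \in U -> (forall u, u \in U -> K u -> 0 <= m u) ->
  exists2 l : 'Hom(V, R^o), (forall u, u \in U -> l u = m u) & dual_cone K l.
Proof.
have [k] := ubnP (\dim {:V} - \dim U); elim: k => // k IH in U m *.
move=> dU eU m0.
have [UT|/subvPn[v _ vU]] := boolP (fullv <= U)%VS.
  by exists m => // x Kx; apply: m0 => //; apply: (subvP UT); exact: memvf.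
have [l lm l0] := positive_extension_step eU m0 vU.
have UUv : (U <= U + <[v]>)%VS by exact: addvSl.
have dUv : (\dim U < \dim (U + <[v]>))%N.
  rewrite ltnNge; apply: contra vU => dUv.
  have /eqP -> : U == (U + <[v]>)%VS by rewrite eqEdim UUv.
  by rewrite (subvP (addvSr U _))// memv_line.
have [||l' l'l Kl'] := IH (U + <[v]>)%VS l _ _ l0.
- rewrite -ltnS; apply: leq_trans dU; rewrite ltnS ltn_sub2l//.
  by apply: (leq_trans dUv); exact: dimvS (subvf _).
- exact: (subvP UUv).
by exists l' => // u uU; rewrite l'l ?lm// (subvP UUv).
Qed.
End PositiveExtension.

(** * Topology of finite-dimensional spaces *)

Section FdTop.
Context {R : realType} {V : vectType R}.

(** In coordinates the form is a finite sum of coordinate functions times constants, and [v2r] is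
    continuous for its initial topology. *)
Lemma fdtop_functional_continuous (f : 'Hom(V, R^o)) :
  continuous (f : fdtop V -> R).
Proof.
pose g (r : 'rV[R]_(dim V)) : R := \sum_j r 0 j * f (r2v 'e_j).
have -> : (f : V -> R) = g \o v2r.
  apply/funext => x /=; rewrite -{1}(v2rK x) {1}(row_sum_delta (v2r x)).
  by rewrite !linear_sum; apply: eq_bigr => j _; rewrite !linearZ.
have gc : continuous g.
  apply: (@continuous_big _ _ +%R) => [|j _ y]; first exact: add_continuous.
  have cj := @coord_continuous R 1 (dim V) 0 j y.
  by apply: cvgM cj _; exact: cvg_cst.
have vc : continuous (v2r : fdtop V -> 'rV[R]_(dim V)).
  exact: initial_continuous.
by move=> x; apply: (continuous_comp (vc x) (gc _)).
Qed.

(** The line [e + t *: x] depends continuously on [t], so it stays in [K] for small [t]. This turns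
    interior points into order units. *)
Lemma interior_ray (K : set V) (e x : V) :
  interior (K : set (fdtop V)) e -> exists2 t : R, 0 < t & K (e + t *: x).
Proof.
move=> Ke; pose g (t : R) : fdtop V := e + t *: x.
have gc : continuous g.
  apply: (@continuous_comp_initial V R 'rV[R]_(dim V) v2r g).
  have -> : v2r \o g = (fun t : R => v2r e + t *: v2r x).
    by apply/funext => s /=; rewrite linearD linearZ.
  move=> t; apply: cvgD; first exact: cvg_cst.
  by apply: cvgZr_tmp; exact: cvg_id.
have : \forall t \near (0 : R), K (g t).
  by apply: gc; rewrite /g scale0r addr0.
move=> /nbhs_ballP[r /= r0 rK]; exists (r / 2); first exact: divr_gt0.
by apply: rK; rewrite /ball/= sub0r normrN gtr0_norm ?divr_gt0//; lra.
Qed.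

(** Heine-Borel: bounds on the coordinate forms enclose [A] in the image of a compact box. *)
Lemma fdtop_compact (A : set (fdtop V)) :
  closed A ->
  (forall f : 'Hom(V, R^o), exists M, forall x, A x -> `|f x| <= M) ->
  compact A.
Proof.
move=> cA bA.
pose coord j := linfun (fun x : V => v2r x 0 j : R^o).
have coordE j x : coord j x = v2r x 0 j.
  have lin : linear (fun z : V => v2r z ord0 j : R^o).
    by move=> a u v; rewrite linearP !mxE.
  pose L : {linear V -> R^o} := HB.pack (fun z : V => v2r z ord0 j : R^o)
    (GRing.isLinear.Build _ _ _ _ _ lin).
  by rewrite (lfunE L).
have [M MA] := choice (fun j => bA (coord j)).
pose P := [set r : 'rV[R]_(dim V) | forall j, `[- M j, M j]%classic (r ord0 j)].
have Pc : compact P.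
  apply: (@rV_compact R (dim V) (fun j => `[- M j, M j]%classic)) => j.
  exact: segment_compact.
apply: (@subclosed_compact _ _ (r2v @` P : set (fdtop V)) cA).
  apply: continuous_compact => //; apply: continuous_subspaceT.
  apply: (@continuous_comp_initial V 'rV[R]_(dim V) 'rV[R]_(dim V) v2r r2v).
  have -> : v2r \o (@r2v R V) = id by apply/funext => r /=; rewrite r2vK.
  by move=> r; exact: cvg_id.
move=> x Ax; exists (v2r x); last exact: v2rK.
by move=> j /=; rewrite in_itv/= -ler_norml -coordE; exact: MA.
Qed.
End FdTop.

(** * Dual cones and their sections *)

Lemma dual_cone_closed (R : realType) (V : vectType R) (S : set V) :
  closed (dual_cone S : set (fdtop 'Hom(V, R^o))).
Proof.
(* An intersection of closed half-spaces, since evaluation at [x] is a linear form on the dual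
   space. *)
have -> : dual_cone S = \bigcap_(x in S) (bidual V x @^-1` [set y | 0 <= y]).
  by apply/seteqP; split => l /= h x Sx; have := h x Sx; rewrite /= bidualE.
apply: closed_bigI => x _; apply: preimage_closed; last exact: closed_ge.
by move=> l _; exact: fdtop_functional_continuous.
Qed.

Lemma dual_cone_convex (R : realType) (V : vectType R) (S : set V) :
  is_convex_cone (dual_cone S).
Proof.
split.
- by exists 0 => x _; rewrite zero_lfunE.
- move=> l l' p /set_mem Sl /set_mem Sl'; apply/mem_set => x Sx.
  rewrite add_lfunE !scale_lfunE; apply: addr_ge0; apply: mulr_ge0 => //.
  + exact: Sl.
  + by rewrite subr_ge0.
  + exact: Sl'.
- move=> a l a0 Sl x Sx; rewrite scale_lfunE; apply: mulr_ge0 => //.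
  exact: Sl.
Qed.

Lemma hsectionE (R : realType) (V : vectType R) (b : V)
    (S : set 'Hom(V, R^o)) :
  hsection b S = S `&` bidual V b @^-1` [set 1].
Proof. by apply/seteqP; split => l [Sl]; rewrite /= bidualE. Qed.

Section OrderUnit.
Context {R : realType} {V : vectType R} (C : set V) (b : V).
Hypothesis Cb : C b.
Hypothesis b_unit : forall x, exists t : R, C (t *: b + x).

(** Applying [l] to [t *: b + x] and [s *: b - x] bounds [l x] on both sides; since [l b] is
    nonnegative, both constants may be raised to their maximum. *)
Lemma dual_cone_unit_bound x :
  exists M : R, forall l, dual_cone C l -> `|l x| <= M * l b.
Proof.
have [t Ct] := b_unit x; have [s Cs] := b_unit (- x).
exists (Num.max t s) => l Cl.
have := Cl _ Ct; rewrite linearD linearZ/= -[_ *: _]/(_ * _) => ht.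
have := Cl _ Cs; rewrite linearB linearZ/= -[_ *: _]/(_ * _) => hs.
have lb : 0 <= l b by exact: Cl.
have tM : t * l b <= Num.max t s * l b by rewrite ler_wpM2r// le_max lexx.
have sM : s * l b <= Num.max t s * l b by rewrite ler_wpM2r// le_max lexx orbT.
by rewrite ler_norml; lra.
Qed.

Lemma dual_cone_hsection_compact :
  compact (hsection b (dual_cone C) : set (fdtop 'Hom(V, R^o))).
Proof.
apply: fdtop_compact => [|f].
  rewrite hsectionE; apply: closedI; first exact: dual_cone_closed.
  apply: preimage_closed; last exact: closed_eq.
  by move=> l _; exact: fdtop_functional_continuous.
(* Every form on the dual space is evaluation at a vector, so the pointwise bound applies. *)
rewrite -(bidualVK f); have [M MP] := dual_cone_unit_bound ((bidual V)^-1%VF f).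
by exists M => l [Cl lb]; rewrite bidualE -[M]mulr1 -lb MP.
Qed.

Lemma dual_cone_hsection_base : b != 0 ->
  is_base (hsection b (dual_cone C)) (dual_cone C).
Proof.
move=> b0; split.
- move=> a l a0 Cl; have [_ _] := dual_cone_convex C; apply => //.
  exact: ltW.
- exists (bidual V b @^-1` [set 1]); last exact: hsectionE.
  exists (bidual V b), 1; split => //.
  apply: contra b0 => /eqP b0; apply/eqP/bidual_inj.
  by rewrite b0 linear0.
(* An affine combination of forms with value 1 at [b] again has value 1 at [b], unlike the zero
   form. *)
- move=> [k [p [a [ph a1]]]] /(congr1 (fun l : 'Hom(V, R^o) => bidual V b l)).
  rewrite linear0 linear_sum (eq_bigr a) ?a1 => [/esym/eqP|i _].
    by rewrite oner_eq0.
  have [_ pb] := ph i.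
  by rewrite linearZ/= bidualE pb -[_ *: _]/(_ * _) mulr1.
- move=> l Cl l0.
  have lb : 0 < l b.
    rewrite lt_def Cl// andbT; apply: contra l0 => /eqP lb.
    apply/eqP/lfunP => x; rewrite zero_lfunE; apply/eqP.
    have [M /(_ _ Cl)] := dual_cone_unit_bound x.
    by rewrite lb mulr0 normr_le0.
  exists ((l b)^-1 *: l), (l b); split => //; last first.
    by rewrite scalerA divff ?scale1r ?gt_eqF.
  split; last by rewrite /= scale_lfunE -[_ *: _]/(_ * _) mulVf ?gt_eqF.
  have [_ _] := dual_cone_convex C; apply => //.
  by rewrite invr_ge0 ltW.
Qed.
End OrderUnit.

(** * Dual cone of a preimage *)

Lemma dual_cone_preimage_extension (R : realType) (V W : vectType R)
    (phi : 'Hom(W, V)) (K : set V) (w : W) (m : 'Hom(W, R^o)) :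
  is_convex_cone K -> (forall x, exists t : R, K (t *: phi w + x)) ->
  dual_cone (phi @^-1` K) m ->
  exists2 l : 'Hom(V, R^o), dual_cone K l & (l \o phi)%VF = m.
Proof.
move=> Kcone w_unit m0.
have mge0 x : phi x = 0 -> 0 <= m x.
  by move=> x0; apply: m0; rewrite /= x0; exact: convex_cone0.
(* The kernel is a subspace contained in the preimage of [K], so nonnegativity applies to both [x]
   and [- x]. *)
have mker x : phi x = 0 -> m x = 0.
  move=> x0; apply/eqP; rewrite eq_le mge0// andbT -oppr_ge0 -linearN.
  by apply: mge0; rewrite linearN/= x0 oppr0.
(* Two preimages of a vector differ by an element of the kernel, so [m] does not see which one is
   chosen. *)
have mphi x : m (phi^-1%VF (phi x)) = m x.
  apply/eqP; rewrite -subr_eq0 -linearB; apply/eqP/mker.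
  by rewrite linearB/= limg_lfunVK ?subrr// memv_img// memvf.
have [||l lm Kl] :=
  @positive_extension _ _ K _ Kcone w_unit (limg phi) (m \o phi^-1)%VF.
- by rewrite memv_img// memvf.
- move=> _ /memv_imgP[x _ ->] Kx.
  by rewrite comp_lfunE mphi; exact: m0.
exists l => //; apply/lfunP => x.
by rewrite comp_lfunE lm ?memv_img ?memvf// comp_lfunE mphi.
Qed.

Theorem proposition5p2 (R : realType) (V : vectType R) (K : set V) (e : V)
    (n : nat) (pi : 'Hom('Hom(V, R^o), 'Hom('rV[R]_n, R^o))) :
  closed (K : set (fdtop V)) ->
  is_convex_cone K ->
  e != 0 ->
  interior (K : set (fdtop V)) e ->
  let B : set 'Hom(V, R^o) := hsection e (dual_cone K) in
  let phi0 : 'Hom((R^o * 'rV[R]_n)%type, V) := predual_map (pi0 e pi) in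
  let C : set (R^o * 'rV[R]_n) := phi0 @^-1` K in
  let Cdual : set 'Hom((R^o * 'rV[R]_n)%type, R^o) := dual_cone C in
  let h : set 'Hom((R^o * 'rV[R]_n)%type, R^o) := hsection b0 Cdual in
  [/\ [/\ pi0 e pi @` dual_cone K = Cdual,
          closed (Cdual : set (fdtop 'Hom((R^o * 'rV[R]_n)%type, R^o))) &
          is_convex_cone Cdual],
      [/\ pi0 e pi @` B = h,
          compact (h : set (fdtop 'Hom((R^o * 'rV[R]_n)%type, R^o))) &
          is_base h Cdual] &
      pi @` B = pi2 @` h].
Proof.
move=> _ Kcone _ Ke B phi0 C Cdual h.
have [_ _ KZ] := Kcone.
(* Dividing [e + t *: x] in [K] by [t > 0] gives the multiple of [e]. *)
have K_unit x : exists t : R, K (t *: e + x).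
  have [t t0 /(KZ t^-1)] := interior_ray x Ke.
  rewrite invr_ge0 scalerDr scalerA mulVf ?gt_eqF// scale1r => Kt.
  by exists t^-1; apply: Kt; exact: ltW.
have phi0E l : (l \o phi0)%VF = pi0 e pi l.
  by apply/lfunP => x; rewrite comp_lfunE predual_mapE.
(* Forms separate points, and each [l] takes the value [pi0 e pi l b0 = l e] at [phi0 b0]. *)
have phi0b : phi0 b0 = e.
  apply: bidual_inj; apply/lfunP => l.
  by rewrite !bidualE predual_mapE pi0E dual_pair_b0.
have Cb0 : C b0 by rewrite /C/= phi0b; exact: (@interior_subset (fdtop V)).
have C_unit x : exists t : R, C (t *: b0 + x).
  have [t Kt] := K_unit (phi0 x); exists t.
  by rewrite /C/= linearD linearZ/= phi0b.
have b0_neq0 : b0 != 0 :> R^o * 'rV[R]_n.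
  by rewrite xpair_eqE/= oner_eq0.
have pi0K : pi0 e pi @` dual_cone K = Cdual.
  apply/seteqP; split => [_ [l Kl <-] x Cx|m Cm].
    by rewrite -phi0E comp_lfunE; exact: Kl.
  have [|l Kl lm] := @dual_cone_preimage_extension _ _ _ phi0 K b0 m Kcone _ Cm.
    by rewrite phi0b.
  by exists l => //; rewrite -phi0E.
have pi0b l : pi0 e pi l b0 = l e by rewrite pi0E dual_pair_b0.
have pi0B : pi0 e pi @` B = h.
  apply/seteqP; split => [_ [l [Kl le] <-]|m []].
    by split; [rewrite -pi0K; exists l | rewrite /= pi0b].
  by rewrite -pi0K => -[l Kl <-] /=; rewrite pi0b => le; exists l.
split; [split => // | split => // |].
- exact: dual_cone_closed.
- exact: dual_cone_convex.
- exact: dual_cone_hsection_compact.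
- exact: dual_cone_hsection_base.
(* The third claim follows from the second because [pi2 \o pi0 e pi] is [pi]. *)
- rewrite -pi0B image_comp; apply: eq_imagel => l _ /=.
  by rewrite pi0E pi2_dual_pair.
Qed.
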